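(* Let $1<n<p$ and $F(u)=\frac{1}{2n}|1-u^2|^n$. Fix $N\in\mathbb{N}$ and $a<h_1<h_2<\dots<h_N<b$. If $\varepsilon>0$ is sufficiently small, then there exist two (distinct) solutions $\varphi$ to $$\varepsilon^p\left(|\varphi'|^{p-2}\varphi'\right)'-F'(\varphi)=0\ \text{ in }(a,b),\qquad \varphi'(a)=\varphi'(b)=0,$$ oscillating between $-1$ and $+1$ and with exactly $N$ zeros, located at $h_1,\dots,h_N$.
   Context: $[a,b]$ is a fixed bounded interval. ''Oscillating between $-1$ and $+1$'' means that $\varphi$ takes values in $[-1,1]$ and attains both values $-1$ and $+1$. Solutions are classical: $\varphi\in C^1([a,b])$, $|\varphi'|^{p-2}\varphi'\in C^1([a,b])$ and the equation holds pointwise. *)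

(* Defs.v *)
From HB Require Import structures.
From mathcomp Require Import all_boot all_order all_algebra.
From mathcomp Require Import all_classical all_reals all_analysis.

Set Implicit Arguments.
Unset Strict Implicit.
Unset Printing Implicit Defensive.

Import Order.TTheory GRing.Theory Num.Theory.
Import numFieldNormedType.Exports.

Local Open Scope classical_set_scope.
Local Open Scope ring_scope.

(* The quotient is restricted to increments staying in [a, b], so that at the
   endpoints the derivative below is the one-sided one, and the values of f
   outside [a, b] are irrelevant. *)
Definition diff_quot_cc (R : realType) (a b : R) (f : R -> R) (x : R) :
    set_system R :=
  (fun y => (f y - f x) / (y - x)) @ within `[a, b]%classic x^'.

Definition derive_cc (R : realType) (a b : R) (f : R -> R) (x : R) : R :=
  lim (diff_quot_cc a b f x).

Definition C1_cc (R : realType) (a b : R) (f : R -> R) : Prop :=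
  (forall x, x \in `[a, b] -> cvg (diff_quot_cc a b f x)) /\
  {within `[a, b], continuous (derive_cc a b f)}.

(* |s|^(p-2) s. For p < 2 it is extended by 0 at s = 0, whatever the value of
   the power there, because of the second factor. *)
Definition p_flux (R : realType) (p s : R) : R := `|s| `^ (p - 2) * s.

Definition potential (R : realType) (n u : R) : R :=
  (2 * n)^-1 * `|1 - u ^+ 2| `^ n.

Definition neumann_solution (R : realType) (a b n p eps : R) (phi : R -> R) :
    Prop :=
  let dphi := derive_cc a b phi in
  let flux := fun x => p_flux p (dphi x) in
  [/\ C1_cc a b phi,
      C1_cc a b flux,
      forall x, x \in `]a, b[ ->
        eps `^ p * derive_cc a b flux x - derive1 (potential n) (phi x) = 0,
      dphi a = 0
    & dphi b = 0].

Definition oscillating (R : realType) (a b : R) (phi : R -> R) : Prop :=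
  [/\ forall x, x \in `[a, b] -> -1 <= phi x <= 1,
      exists2 x, x \in `[a, b] & phi x = -1
    & exists2 x, x \in `[a, b] & phi x = 1].

Definition zeros_at (R : realType) (a b : R) (N : nat) (h : 'I_N -> R)
    (phi : R -> R) : Prop :=
  forall x, x \in `[a, b] -> (phi x = 0 <-> exists i : 'I_N, x = h i).

(* Main.v *)
Require Import Defs.
From HB Require Import structures.
From mathcomp Require Import all_boot all_order all_algebra.
From mathcomp Require Import all_classical all_reals all_analysis.
From mathcomp Require Import ring lra.

Set Implicit Arguments.
Unset Strict Implicit.
Unset Printing Implicit Defensive.

Import Order.TTheory GRing.Theory Num.Theory.
Import numFieldNormedType.Exports.

Local Open Scope classical_set_scope.
Local Open Scope ring_scope.

(** Multiplying the equation by the derivative shows that the energy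
    (1 - 1/p) eps^p |phi'|^p - F(phi) is constant.  On the level set 0 it
    becomes the first-order equation |phi'| = ka (1 - phi^2)^(n/p) with
    ka = c / eps and c^p = 1 / (2 (n - n/p)).  Since n < p the exponent
    al = n/p is below 1, so the right-hand side is not Lipschitz at the wells:
    a solution leaves -1 and reaches +1 in finite time, and may then rest there
    for as long as desired.  Such a transition occupies an interval of length
    2 T / ka, proportional to eps.  For small eps one transition can thus be
    centred at each h_i without any overlap, the solution being locally
    constant, equal to +1 or -1, in between and at both endpoints.

    The transition profile w has to satisfy w' = (1 - w^2)^al on the whole
    line, and the flux, a multiple of (1 - w^2)^(n - al), has to be C^1 although
    n - al may be smaller than 1.  Both facts are clear in a parameter r
    for which the wells are attained at r = 1 and r = -1: with
    k = 1 / (1 - al) > 1 and [pospow k x] = max(x, 0)^k, put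
      [ratio k r] = (pospow k (1 + r) - pospow k (1 - r))
                    / (pospow k (1 + r) + pospow k (1 - r)).
    Then 1 - ratio^2 = pospow k (1 - r^2) m(r) with m > 0
    ([ratio_defect]), and ratio' = k m^(1 - al) (1 - ratio^2)^al.  It remains
    to solve the regular equation r' = 1 / (k m(r)^(1 - al)), by inverting a
    primitive ([autonomous_ode_solution]), and to set w = ratio o r
    ([transition_profile_exists]).  Powers of 1 - w^2 with exponent be > 1 - al
    are C^1 because k be > 1.

    The solution is phi(x) = s prod_i w (ka (x - h_i)) with s = 1 or s = -1.
    Near any point all factors but one are locally constant, equal to 1 or -1,
    so that phi is there a signed single layer ([layer_train_near]); this makes
    it a solution of the odd equation ([layer_near]), and lets the product take
    care of the alternation of signs. *)

(** * Primitives and autonomous equations *)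

Lemma is_derive1_continuous (R : realType) (f : R -> R) (x l : R) :
  is_derive x 1 f l -> {for x, continuous f}.
Proof. by move=> [/derivable1_diffP/differentiable_continuous]. Qed.

(** The integral from a base point is a primitive to the right of that point
    only.  By Chasles' relation, near each x the oriented integral from 0
    differs by a constant from an integral based at some M < x. *)
Lemma continuous_primitive (R : realType) (f : R -> R) : continuous f ->
  exists F : R -> R, forall x : R, is_derive x 1 F (f x).
Proof.
move=> cf.
have [J [J0 JD dJ]] : exists J : R -> R -> R,
    [/\ forall u v, v <= u -> J u v = 0,
        forall u v w, u <= v <= w -> J u w = J u v + J v w
      & forall u x : R, u < x -> is_derive x 1 (J u) (f x)].
  pose mu := @lebesgue_measure R.
  have intf (u v : R) : mu.-integrable `[u, v] (EFin \o f).
    apply: continuous_compact_integrable; first exact: segment_compact.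
    exact: continuous_subspaceT.
  exists (fun u v => \int[mu]_(t in `[u, v]) f t)%R; split.
  - move=> u v; rewrite le_eqVlt => /predU1P[->|vu].
      by rewrite set_itv1 Rintegral_set1.
    by rewrite set_itv_ge ?Rintegral_set0// bnd_simp -ltNge.
  - move=> u v w /andP[uv vw].
    apply/eqP; rewrite addrC -subr_eq; apply/eqP.
    rewrite (@Rintegral_itvB _ _ (BLeft u) (BRight w) v)//.
    rewrite Rintegral_itv_obnd_cbnd//; apply: integrableS (intf v w) => //.
    by apply: subset_itvr; rewrite bnd_simp.
  - move=> u x ux; have [dJ J'] := continuous_FTC1_closed
      (ltr_pwDr ltr01 (lexx _)) (intf u (x + 1)) ux (cf x).
    exact: (DeriveDef dJ (etrans (esym (derive1E _ _)) J')).
exists (fun x => J 0 x - J x 0) => x.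
(* M lies below both x and the base point 0. *)
pose M := Num.min x 0 - 1.
have M0 : M <= 0 by rewrite /M; case: (leP x 0) => ?; lra.
have Mx : M < x by rewrite /M; case: (leP x 0) => ?; lra.
have FE y : M <= y -> J M y - J M 0 = J 0 y - J y 0.
  move=> My; case: (leP y 0) => y0.
    by rewrite (J0 0 y)// (JD M y 0) ?My//; ring.
  by rewrite (J0 y 0) ?(ltW y0)// (JD M 0 y) ?M0 ?ltW//; ring.
apply: (@near_eq_is_derive _ _ _ (fun y => J M y - J M 0)).
  by near=> y; apply: FE; apply/ltW; near: y; exact: lt_nbhsr.
have dJM := dJ M x Mx.
by rewrite -[f x]subr0; exact: is_deriveB.
Unshelve. all: by end_near. Qed.

(** By separation of variables, a solution is the inverse of the primitive of g
    that vanishes at 0; the lower bound m on g makes that primitive a bijection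
    of the line. *)
Lemma autonomous_ode_solution (R : realType) (g : R -> R) (m : R) :
    continuous g -> 0 < m -> (forall x, m <= g x) ->
  exists r : R -> R, [/\ r 0 = 0, {mono r : s t / s <= t},
    (forall x, exists t, r t = x) & forall t : R, is_derive t 1 r (g (r t))^-1].
Proof.
move=> cg m0 mg.
have [G0 dG0] := continuous_primitive cg.
pose G x := G0 x - G0 0.
have dG (x : R) : is_derive x 1 G (g x).
  by rewrite -[g x]subr0; apply: is_deriveB.
have cG : continuous G by move=> x; exact: is_derive1_continuous (dG x).
have g0 x : 0 < g x by exact: lt_le_trans (mg x).
have growth x y : x <= y -> m * (y - x) <= G y - G x.
  move=> xy; have [|c _ ->] := @MVT_segment _ G g x y xy (fun z _ => dG z).
    exact: continuous_subspaceT.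
  by rewrite ler_wpM2r// subr_ge0.
have G00 : G 0 = 0 by rewrite /G subrr.
have surj t : exists x, G x = t.
  pose b := `|t| / m.
  have b0 : 0 <= b by rewrite divr_ge0// ltW.
  have mb : m * b = `|t| by rewrite mulrCA divff ?mulr1 ?gt_eqF.
  have h1 := growth 0 b b0; have h2 := growth (- b) 0 ltac:(lra).
  have [tl tu] : - `|t| <= t /\ t <= `|t|
    by rewrite ler_norm lerNl -normrN ler_norm.
  have [||x _ <-] := @IVT _ G (- b) b t ltac:(lra);
    first exact: continuous_subspaceT.
    by rewrite ge_min le_max; apply/andP; split; apply/orP; [left|right]; lra.
  by exists x.
pose r t := projT1 (cid (surj t)).
have rK : cancel r G by move=> t; rewrite /r; case: cid.
have Gmono x y : (G x <= G y) = (x <= y).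
  have lt u v : u < v -> G u < G v.
    by move=> uv; have := growth u v (ltW uv);
      have := mulr_gt0 m0 (ltac:(lra) : 0 < v - u); lra.
  case: (leP x y) => [|/lt]; last by move=> /lt_geF.
  by rewrite le_eqVlt => /predU1P[->|/lt/ltW//]; rewrite lexx.
have Gr : cancel G r.
  by move=> x; apply/eqP; rewrite eq_le -Gmono rK lexx -Gmono rK lexx.
exists r; split => [|s t|x|t].
- by rewrite -G00 Gr.
- by rewrite -[LHS]Gmono !rK.
- by exists (G x).
- rewrite -{1}(rK t); apply: is_derive_inverse; last by rewrite gt_eqF.
  + by near=> x; exact: Gr.
  + by near=> x; exact: cG.
Unshelve. all: by end_near. Qed.

(** * Powers of the positive part *)

Definition pospow (R : realType) (k x : R) : R := Num.max x 0 `^ k.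

Lemma pospowE (R : realType) (k x : R) : 0 <= x -> pospow k x = x `^ k.
Proof. by move=> x0; rewrite /pospow max_l. Qed.

Lemma pospow_le0 (R : realType) (k x : R) : k != 0 -> x <= 0 -> pospow k x = 0.
Proof. by move=> k0 x0; rewrite /pospow max_r ?powR0. Qed.

Lemma pospow_ge0 (R : realType) (k x : R) : 0 <= pospow k x.
Proof. exact: powR_ge0. Qed.

Lemma pospow_continuous (R : realType) (k : R) : 0 < k ->
  continuous (pospow k : R -> R).
Proof.
move=> k0 x; have [x0|x0|->] := ltgtP x 0.
- apply: (@is_derive1_continuous _ _ _ 0).
  apply: near_eq_is_derive (is_derive_cst (0 : R) x (1 : R)).
  near=> y; rewrite pospow_le0 ?gt_eqF//; apply/ltW; near: y; exact: lt_nbhsl.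
- apply: (@is_derive1_continuous _ _ _ (k * x `^ (k - 1))).
  apply: near_eq_is_derive (is_derive1_powR k x0).
  near=> y; rewrite pospowE//; apply/ltW; near: y; exact: lt_nbhsr.
- apply/cvgrPdist_lt => e e0; rewrite (pospow_le0 _ (lexx _)) ?gt_eqF//.
  near=> y; rewrite sub0r normrN ger0_norm ?pospow_ge0//.
  have -> : e = (e `^ k^-1) `^ k by rewrite -powRrM mulVf ?gt_eqF//
    powRr1// ltW.
  apply: gt0_ltr_powR; rewrite ?nnegrE ?powR_ge0// ?le_max ?lexx ?orbT//.
  rewrite gt_max powR_gt0// andbT; near: y; apply: lt_nbhsl.
  by rewrite powR_gt0.
Unshelve. all: by end_near. Qed.

(** At the kink, the difference quotient is the function pospow (k - 1), which
    tends to 0 since k > 1. *)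
Lemma is_derive1_pospow (R : realType) (k x : R) : 1 < k ->
  is_derive x 1 (pospow k) (k * pospow (k - 1) x).
Proof.
move=> k1; have k0 : k != 0 by rewrite gt_eqF//; lra.
have k10 : 0 < k - 1 by lra.
have [x0|x0|->] := ltgtP x 0.
- rewrite pospow_le0 ?gt_eqF// ?ltW// mulr0.
  apply: near_eq_is_derive (is_derive_cst (0 : R) x (1 : R)).
  near=> y; rewrite pospow_le0//; apply/ltW; near: y; exact: lt_nbhsl.
- rewrite pospowE ?ltW//.
  apply: near_eq_is_derive (is_derive1_powR k x0).
  near=> y; rewrite pospowE//; apply/ltW; near: y; exact: lt_nbhsr.
- apply/is_derive1_caratheodory; exists (pospow (k - 1)); split => [z||].
  + rewrite [pospow k 0]pospow_le0// !subr0.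
    have [z0|z0] := leP z 0;
      first by rewrite (pospow_le0 k0 z0) pospow_le0 ?mul0r ?gt_eqF.
    by rewrite !pospowE ?ltW// mulrC mulr_powRB1//; lra.
  + exact: pospow_continuous.
  + by rewrite pospow_le0 ?mulr0 ?gt_eqF.
Unshelve. all: by end_near. Qed.

Lemma pospowM (R : realType) (k x y : R) : 0 <= x -> 0 <= y ->
  pospow k (x * y) = pospow k x * pospow k y.
Proof. by move=> x0 y0; rewrite !pospowE ?mulr_ge0// powRM. Qed.

(** * A parametrization of [-1, 1] with flat ends *)

Definition weight (R : realType) (k r : R) : R :=
  pospow k (1 - r) + pospow k (1 + r).

(** The value is 1 for r >= 1 and -1 for r <= -1.  In between it is
    tanh (k artanh r), for which the defect 1 - ratio^2 vanishes at the ends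
    like the power k of the distance. *)
Definition ratio (R : realType) (k r : R) : R :=
  (pospow k (1 + r) - pospow k (1 - r)) / weight k r.

Lemma weight_gt0 (R : realType) (k r : R) : 0 < weight k r.
Proof.
have [r0|r0] := leP r 0.
  by rewrite ltr_wpDr ?pospow_ge0// pospowE ?powR_gt0//; lra.
by rewrite ltr_wpDl ?pospow_ge0// pospowE ?powR_gt0//; lra.
Qed.

Lemma weight_le (R : realType) (k r : R) : 0 <= k -> -1 <= r <= 1 ->
  weight k r <= 2 * 2 `^ k.
Proof.
move=> k0 /andP[r1 r2].
have le2 x : 0 <= x <= 2 -> pospow k x <= 2 `^ k.
  by move=> /andP[x0 x2]; rewrite pospowE// ge0_ler_powR ?nnegrE; lra.
have h1 := le2 (1 - r) ltac:(lra); have h2 := le2 (1 + r) ltac:(lra).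
by rewrite /weight; lra.
Qed.

Lemma pospow_pair (R : realType) (k r : R) : k != 0 ->
  pospow k (1 - r) * pospow k (1 + r) = pospow k (1 - r ^+ 2).
Proof.
move=> k0; have -> : 1 - r ^+ 2 = (1 - r) * (1 + r) by ring.
have [r1|r1] := leP 1 r.
  by rewrite (@pospow_le0 _ k (1 - r)) ?mul0r ?pospow_le0//; nra.
have [r2|r2] := leP r (-1).
  by rewrite (@pospow_le0 _ k (1 + r)) ?mulr0 ?pospow_le0//; nra.
by rewrite pospowM//; lra.
Qed.

(** With A and B the two terms of the weight, (A + B)^2 - (B - A)^2 = 4 A B. *)
Lemma ratio_defect (R : realType) (k r : R) : k != 0 ->
  1 - ratio k r ^+ 2 = pospow k (1 - r ^+ 2) * (4 / weight k r ^+ 2).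
Proof.
move=> k0; rewrite -pospow_pair// /ratio.
have := weight_gt0 k r; rewrite /weight => /gt_eqF /negbT ?.
by field.
Qed.

Lemma ratio_ge1 (R : realType) (k r : R) : k != 0 -> 1 <= r -> ratio k r = 1.
Proof.
move=> k0 r1; have := weight_gt0 k r; rewrite /ratio /weight.
rewrite (@pospow_le0 _ k (1 - r)) ?add0r ?subr0 ?subr_le0// => /gt_eqF /negbT.
exact: divff.
Qed.

Lemma ratioN (R : realType) (k r : R) : ratio k (- r) = - ratio k r.
Proof.
by rewrite /ratio /weight opprK [pospow k (1 - r) + _]addrC -mulNr opprB.
Qed.

Lemma ratio_eq0 (R : realType) (k r : R) : 0 < k ->
  ratio k r = 0 <-> r = 0.
Proof.
move=> k0; split=> [/eqP|->]; last by rewrite /ratio subr0 addr0 subrr mul0r.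
wlog r0 : r / 0 <= r => [hw|].
  have [|r0] := leP 0 r; first exact: hw.
  rewrite -oppr_eq0 -ratioN => /hw; lra.
have [->//|rn0] := eqVneq r 0.
have rp : 0 < r by rewrite lt_neqAle eq_sym rn0.
rewrite mulf_eq0 invr_eq0 (gt_eqF (weight_gt0 _ _)) orbF subr_eq0 => /eqP.
have [r1|r1] := leP 1 r.
  rewrite (@pospow_le0 _ k (1 - r)) ?gt_eqF// ?subr_le0// pospowE; last lra.
  by move/powR_eq0_eq0; lra.
rewrite !pospowE; [|lra|lra]; move/(powR_injective k0).
by rewrite !nnegrE => /(_ ltac:(lra) ltac:(lra)); lra.
Qed.

(** The product of the two one-sided powers of exponent k - 1 comes out because
    (1 - r) + (1 + r) = 2; outside [-1, 1] both sides vanish. *)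
Lemma is_derive1_ratio (R : realType) (k r : R) : 1 < k ->
  is_derive r 1 (ratio k)
    (k * pospow (k - 1) (1 - r ^+ 2) * (4 / weight k r ^+ 2)).
Proof.
move=> k1.
have k0 : k != 0 by rewrite gt_eqF//; lra.
have k10 : k - 1 != 0 by rewrite gt_eqF//; lra.
have dB : is_derive r 1 (fun r => pospow k (1 + r))
    (k * pospow (k - 1) (1 + r)).
  rewrite -[X in is_derive _ _ _ X]mulr1.
  apply: (@is_derive1_comp _ (pospow k) (fun r => 1 + r)).
    exact: is_derive1_pospow.
  by rewrite -[X in is_derive _ _ _ X]add0r; exact: is_deriveD.
have dA : is_derive r 1 (fun r => pospow k (1 - r))
    (- (k * pospow (k - 1) (1 - r))).
  rewrite -[X in is_derive _ _ _ X]mulrN1.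
  apply: (@is_derive1_comp _ (pospow k) (fun r => 1 - r)).
    exact: is_derive1_pospow.
  by rewrite -[X in is_derive _ _ _ X]sub0r; exact: is_deriveB.
have w0 : weight k r != 0 by rewrite gt_eqF// weight_gt0.
have dS := is_deriveV w0 (is_deriveD dA dB).
have dQ := is_deriveM (is_deriveB dB dA) dS.
apply: is_derive_eq dQ _.
rewrite /GRing.scale/= -pospow_pair//.
have key : pospow (k - 1) (1 + r) * pospow k (1 - r) +
    pospow (k - 1) (1 - r) * pospow k (1 + r) =
    2 * (pospow (k - 1) (1 - r) * pospow (k - 1) (1 + r)).
  have step x : 0 <= x -> pospow k x = x * pospow (k - 1) x.
    by move=> x0; rewrite !pospowE// mulr_powRB1//; lra.
  have [r1|r1] := leP 1 r.
    by rewrite !(@pospow_le0 _ _ (1 - r)) ?subr_le0//; ring.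
  have [r2|r2] := leP r (-1).
    by rewrite !(@pospow_le0 _ _ (1 + r)) //; [ring|lra|lra].
  by rewrite !step; [ring|lra|lra].
rewrite -[RHS](_ : 2 * k * (pospow (k - 1) (1 + r) * pospow k (1 - r) +
  pospow (k - 1) (1 - r) * pospow k (1 + r)) / weight k r ^+ 2 = _); last first.
  by rewrite key; field.
change ((pospow k (1 + r) - pospow k (1 - r)) * (- weight k r ^- 2 *
  (- (k * pospow (k - 1) (1 - r)) + k * pospow (k - 1) (1 + r))) +
  (weight k r)^-1 *
  (k * pospow (k - 1) (1 + r) - - (k * pospow (k - 1) (1 - r))) =
  2 * k * (pospow (k - 1) (1 + r) * pospow k (1 - r) +
  pospow (k - 1) (1 - r) * pospow k (1 + r)) / weight k r ^+ 2).
move: w0; rewrite /weight => w0.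
by field.
Qed.

(** * The transition profile *)

Lemma weight_continuous (R : realType) (k : R) : 0 < k ->
  continuous (weight k : R -> R).
Proof.
move=> k0 x; apply: cvgD.
  apply: (@continuous_comp _ _ _ (fun r : R => 1 - r) (pospow k)).
    by apply: continuousB; [exact: cst_continuous|exact: id].
  exact: pospow_continuous.
apply: (@continuous_comp _ _ _ (fun r : R => 1 + r) (pospow k)).
  by apply: continuousD; [exact: cst_continuous|exact: id].
exact: pospow_continuous.
Qed.

Lemma weight_factor_continuous (R : realType) (k : R) : 0 < k ->
  continuous (fun r : R => 4 / weight k r ^+ 2).
Proof.
move=> k0 x; have w0 := weight_gt0 k x.
apply: (@continuousM _ _ (cst (4 : R)) (fun r => (weight k r ^+ 2)^-1));
  first exact: cst_continuous.
apply: (@continuousV _ _ (fun r => weight k r ^+ 2));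
  first by rewrite expf_neq0// gt_eqF.
rewrite (_ : (fun r => weight k r ^+ 2) = (fun r => weight k r * weight k r));
  last first.
  by apply/funext => r; rewrite expr2.
by apply: continuousM; exact: weight_continuous.
Qed.

(** The defect 1 - ratio^2 is a positive continuous factor times a power k of the
    distance to the ends, so its power b vanishes there to the order k b: the
    derivative is 0 as soon as k b > 1, even if b < 1. *)
Lemma is_derive1_ratio_defect_powR (R : realType) (k b r : R) :
    0 < k -> 0 < b -> 1 < k * b -> 1 <= r ^+ 2 ->
  is_derive r 1 (fun r => (1 - ratio k r ^+ 2) `^ b) 0.
Proof.
move=> k0 b0 kb r1.
have hE z : (1 - ratio k z ^+ 2) `^ b =
    pospow (k * b) (1 - z ^+ 2) * pospow b (4 / weight k z ^+ 2).
  rewrite ratio_defect ?gt_eqF// powRM ?pospow_ge0//; last first.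
    by rewrite divr_ge0// sqr_ge0.
  by rewrite {1}/pospow -powRrM [pospow b _]pospowE// divr_ge0// sqr_ge0.
have kb10 : 0 < k * b - 1 by lra.
have F0 : pospow (k * b) (1 - r ^+ 2) = 0 by rewrite pospow_le0 ?gt_eqF//; lra.
have : is_derive r 1 (fun z => pospow (k * b) (1 - z ^+ 2)) 0.
  rewrite -[X in is_derive _ _ _ X]
    (_ : k * b * pospow (k * b - 1) (1 - r ^+ 2) * (- (2 * r)) = 0).
    apply: (@is_derive1_comp _ (pospow (k * b)) (fun z => 1 - z ^+ 2)).
      exact: is_derive1_pospow.
    have d1 := is_deriveB (is_derive_cst (1 : R) r (1 : R))
      (is_deriveX 2 (is_derive_id r (1 : R))).
    by apply: is_derive_eq d1 _; rewrite /GRing.scale/=; ring.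
  by rewrite pospow_le0 ?gt_eqF ?mulr0 ?mul0r//; lra.
move/is_derive1_caratheodory => [q [qE cq q0]].
apply/is_derive1_caratheodory.
exists (fun z => q z * pospow b (4 / weight k z ^+ 2)); split => [z||].
- by rewrite !hE F0 mul0r subr0 mulrAC -qE F0 subr0.
- apply: (@continuousM _ _ q (fun z => pospow b (4 / weight k z ^+ 2))) => //.
  apply: (@continuous_comp _ _ _ (fun z => 4 / weight k z ^+ 2) (pospow b)).
    exact: weight_factor_continuous.
  exact: pospow_continuous.
- by rewrite q0 mul0r.
Qed.

(** For be < 1 the second clause does not follow from the first by the chain
    rule: y^be is not differentiable at y = 0, which is the value of 1 - w^2
    wherever w has reached 1 or -1. *)
Definition transition_profile (R : realType) (al T : R) (w : R -> R) : Prop :=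
  [/\ forall t : R, is_derive t 1 w ((1 - w t ^+ 2) `^ al),
      forall be, 1 - al < be -> forall t : R, is_derive t 1
        (fun t => (1 - w t ^+ 2) `^ be)
        (- (2 * be * w t * (1 - w t ^+ 2) `^ (be + al - 1))),
      forall t, w t = 0 <-> t = 0,
      forall t, -1 <= w t <= 1
    & forall t, T <= t -> w t = 1 /\ w (- t) = -1].

(** The composite of [ratio] with the solution r of r' = 1 / g, where
    g = k m^(1 - al) is the factor such that ratio' = (1 - ratio^2)^al g.  Only
    the values of g on [-1, 1] matter, since the defect vanishes elsewhere; g is
    therefore truncated from below to make r a bijection of the line. *)
Lemma transition_profile_exists (R : realType) (al : R) : 0 < al < 1 ->
  exists (w : R -> R) (T : R), 0 < T /\ transition_profile al T w.
Proof.
move=> /andP[al0 al1].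
have a1 : 0 < 1 - al by lra.
have powE (y : R) : 0 < y -> y `^ al * y `^ (1 - al) = y.
  move=> y0; rewrite -powRD; last by rewrite (gt_eqF y0) implybT.
  by rewrite (_ : al + (1 - al) = 1) ?powRr1 ?ltW//; ring.
pose k := (1 - al)^-1.
have kal : k * (1 - al) = 1 by rewrite /k mulVf// gt_eqF.
have k0 : 0 < k by rewrite invr_gt0.
have k1 : 1 < k by nra.
have kn0 : k != 0 by rewrite gt_eqF.
pose m (r : R) := 4 / weight k r ^+ 2.
have m0 r : 0 < m r by rewrite divr_gt0// exprn_gt0// weight_gt0.
(* A lower bound of m on [-1, 1], where the weight is at most 2 * 2^k. *)
pose mu : R := 4 / (2 * 2 `^ k) ^+ 2.
have mu0 : 0 < mu by rewrite divr_gt0// exprn_gt0// mulr_gt0// powR_gt0.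
have mum r : -1 <= r <= 1 -> mu <= m r.
  move=> r1; rewrite ler_pM2l// lef_pV2 ?posrE ?exprn_gt0 ?mulr_gt0 ?powR_gt0
    ?weight_gt0//.
  have := weight_le (ltW k0) r1; have := weight_gt0 k r; nra.
pose g r := k * pospow (1 - al) (Num.max (m r) mu).
have cg : continuous (g : R -> R).
  move=> x; apply: (@continuousM _ _ (cst k)
      (fun r => pospow (1 - al) (Num.max (m r) mu))).
    exact: cst_continuous.
  apply: (@continuous_comp _ _ _ (fun r => Num.max (m r) mu) (pospow (1 - al))).
    apply: (@continuous_max _ _ m (cst mu)); last exact: cst_continuous.
    exact: weight_factor_continuous.
  exact: pospow_continuous.
have gm r : k * mu `^ (1 - al) <= g r.
  rewrite ler_pM2l// pospowE ?le_max ?(ltW mu0) ?orbT//.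
  by rewrite ge0_ler_powR ?nnegrE ?le_max ?(ltW mu0) ?lexx ?orbT// ltW.
have gm0 : 0 < k * mu `^ (1 - al) by rewrite mulr_gt0// powR_gt0.
have [r [r0 rmono rsurj dr]] := autonomous_ode_solution cg gm0 gm.
have v0 x : 1 <= x ^+ 2 -> 1 - ratio k x ^+ 2 = 0.
  by move=> x1; rewrite ratio_defect// pospow_le0 ?mul0r// subr_le0.
have vp x : x ^+ 2 < 1 -> 0 < 1 - ratio k x ^+ 2.
  by move=> x1; rewrite ratio_defect// mulr_gt0 ?m0// pospowE ?powR_gt0; lra.
have du (x : R) : is_derive x 1 (ratio k) ((1 - ratio k x ^+ 2) `^ al * g x).
  apply: is_derive_eq (is_derive1_ratio x k1) _.
  have [x1|x1] := leP 1 (x ^+ 2).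
    by rewrite v0// powR0 ?gt_eqF// mul0r pospow_le0 ?mulr0 ?mul0r//; lra.
  have xin : -1 <= x <= 1 by apply/andP; split; nra.
  rewrite /g max_l ?mum// ratio_defect// powRM ?pospow_ge0 ?(ltW (m0 _))//.
  have x2 : 0 <= 1 - x ^+ 2 by lra.
  rewrite !pospowE ?(ltW (m0 _))//.
  rewrite -powRrM (_ : k * al = k - 1); last by move: kal; lra.
  have := powE _ (m0 x); rewrite /m; move: (4 / _) => y yE.
  by rewrite -{1}yE; ring.
have g0 x : 0 < g x by exact: lt_le_trans (gm x).
have dw (t : R) : is_derive t 1 (ratio k \o r)
    ((1 - (ratio k (r t)) ^+ 2) `^ al).
  rewrite -[X in is_derive _ _ _ X](mulfK (lt0r_neq0 (g0 (r t)))).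
  exact: is_derive1_comp.
have [t1 rt1] := rsurj 1; have [t2 rt2] := rsurj (-1).
have t1p : 0 < t1 by rewrite ltNge -rmono rt1 r0 -ltNge.
exists (ratio k \o r), (Num.max t1 (- t2)); split; first by rewrite lt_max t1p.
split => [//|be hbe t|t|t|t].
- have be0 : 0 < be by lra.
  have [x1|x1] := leP 1 (r t ^+ 2).
    rewrite /= v0// powR0; last by rewrite gt_eqF//; lra.
    rewrite mulr0 oppr0 -(mul0r (g (r t))^-1).
    apply: (@is_derive1_comp _ (fun x => (1 - ratio k x ^+ 2) `^ be) r) => //.
    by apply: is_derive1_ratio_defect_powR => //; nra.
  have vt := vp _ x1.
  have d1 : is_derive t 1 (fun s => 1 - ratio k (r s) ^+ 2)
      (- (2 * ratio k (r t) * (1 - ratio k (r t) ^+ 2) `^ al)).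
    have d := is_deriveB (is_derive_cst (1 : R) t (1 : R))
      (is_deriveX 2 (dw t)).
    by apply: is_derive_eq d _; rewrite /GRing.scale/=; ring.
  have d2 := @is_derive1_comp R (fun y : R => y `^ be)
    (fun s => 1 - ratio k (r s) ^+ 2) t _ _ (is_derive1_powR be vt) d1.
  apply: is_derive_eq d2 _ => /=.
  rewrite (_ : be + al - 1 = (be - 1) + al); last by ring.
  by rewrite (@powRD _ _ (be - 1) al) ?(gt_eqF vt) ?implybT//; ring.
- rewrite /= ratio_eq0//; split => [rt|->]; last by rewrite r0.
  by apply/eqP; rewrite eq_le -(rmono t 0) -(rmono 0 t) rt r0 lexx.
- have : 0 <= 1 - ratio k (r t) ^+ 2.
    by have [/v0->|/vp/ltW] := leP 1 (r t ^+ 2).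
  by rewrite /= => ?; apply/andP; split; nra.
- rewrite ge_max => /andP[t1t t2t]; split.
    by rewrite /= ratio_ge1// -rt1 rmono.
  rewrite /= -[ratio k _]opprK -ratioN ratio_ge1//.
  by rewrite lerNr -rt2 rmono lerNl.
Qed.

(** * Classical solutions on a closed interval *)

Lemma within_cc_dnbhs_proper (R : realType) (a b x : R) : a < b ->
  x \in `[a, b] -> ProperFilter (within `[a, b]%classic x^').
Proof.
move=> ab; rewrite in_itv/= => /andP[ax xb].
split; last exact: within_filter.
rewrite /within/= => -[e /= e0 he].
have [xltb|blex] := ltP x b.
  pose d := Num.min (e / 2) (b - x).
  have d0 : 0 < d by rewrite lt_min; apply/andP; split; lra.
  have de : d < e by rewrite gt_min; apply/orP; left; lra.
  have db : d <= b - x by rewrite ge_min lexx orbT.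
  apply: (he (x + d)); rewrite /= ?in_itv/=.
  - by rewrite opprD addNKr normrN gtr0_norm.
  - by rewrite gt_eqF//; lra.
  - by apply/andP; split; lra.
pose d := Num.min (e / 2) (x - a).
have d0 : 0 < d by rewrite lt_min; apply/andP; split; lra.
have de : d < e by rewrite gt_min; apply/orP; left; lra.
have da : d <= x - a by rewrite ge_min lexx orbT.
apply: (he (x - d)); rewrite /= ?in_itv/=.
- by rewrite opprB addrC subrK gtr0_norm.
- by rewrite lt_eqF//; lra.
- by apply/andP; split; lra.
Qed.

(** A derivative on the line restricts to the one-sided derivatives at the
    endpoints.  The function f only has to agree with g on [a, b], because the
    flux is known there only. *)
Lemma is_derive1_derive_cc (R : realType) (a b : R) (f g : R -> R) (x l : R) :
    a < b -> {in `[a, b], f =1 g} -> x \in `[a, b] -> is_derive x 1 g l ->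
  cvg (diff_quot_cc a b f x) /\ derive_cc a b f x = l.
Proof.
move=> ab fg xab /is_derive1_caratheodory [q [qE cq ql]].
have xP := within_cc_dnbhs_proper ab xab.
have H : diff_quot_cc a b f x --> l.
  rewrite -ql; have cq' : q @ within `[a, b]%classic x^' --> q x.
    apply: cvg_within_filter; exact: cvg_within_filter.
  apply: cvg_trans cq'; apply: near_eq_cvg.
  rewrite near_withinE near_withinE; near=> y => yx yab.
  by rewrite !fg// qE mulfK// subr_eq0.
split; first by apply/cvg_ex; exists l.
exact: cvg_lim H.
Unshelve. all: by end_near. Qed.

Lemma neumann_solution_of_is_derive (R : realType) (a b n p eps : R)
    (phi d e : R -> R) : a < b ->
    (forall x : R, is_derive x 1 phi (d x)) -> continuous d ->
    (forall x : R, is_derive x 1 (p_flux p \o d) (e x)) -> continuous e ->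
    (forall x, eps `^ p * e x = derive1 (potential n) (phi x)) ->
    d a = 0 -> d b = 0 ->
  neumann_solution a b n p eps phi.
Proof.
move=> ab dphi cd dflux ce eqn da db.
have D x (xab : x \in `[a, b]) :=
  is_derive1_derive_cc ab (fun _ _ => erefl) xab (dphi x).
have DF x (xab : x \in `[a, b]) :
    cvg (diff_quot_cc a b (fun x => p_flux p (derive_cc a b phi x)) x) /\
    derive_cc a b (fun x => p_flux p (derive_cc a b phi x)) x = e x.
  apply: is_derive1_derive_cc (dflux x) => // y yab.
  by rewrite (D y yab).2.
have aab : a \in `[a, b] by rewrite in_itv/= lexx ltW.
have bab : b \in `[a, b] by rewrite in_itv/= lexx ltW.
have sub_oc x : x \in `]a, b[ -> x \in `[a, b].
  by rewrite !in_itv/= => /andP[/ltW -> /ltW ->].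
split.
- split => [x /D[]//|].
  apply: (@subspace_eq_continuous _ _ _ d); last exact: continuous_subspaceT.
  by move=> x /set_mem /= /D[].
- split => [x /DF[]//|].
  apply: (@subspace_eq_continuous _ _ _ e); last exact: continuous_subspaceT.
  by move=> x /set_mem /= /DF[].
- by move=> x /sub_oc xab; rewrite (DF x xab).2 eqn subrr.
- by rewrite (D a aab).2.
- by rewrite (D b bab).2.
Qed.

(** Writing |y|^n = pospow n y + pospow n (- y) gives the derivative also at the
    wells u = 1 and u = -1, where y = 1 - u^2 vanishes. *)
Lemma derive1_potential (R : realType) (n u : R) : 1 < n -> -1 <= u <= 1 ->
  derive1 (potential n) u = - (u * (1 - u ^+ 2) `^ (n - 1)).
Proof.
move=> n1 /andP[u1 u2]; have n0 : n != 0 by rewrite gt_eqF//; lra.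
have v0 : 0 <= 1 - u ^+ 2 by nra.
have dv (s : R) : is_derive u 1 (fun u => s * (1 - u ^+ 2)) (- (s * (2 * u))).
  have d := is_deriveZ s (is_deriveB (is_derive_cst (1 : R) u (1 : R))
    (is_deriveX 2 (is_derive_id u (1 : R)))).
  by apply: is_derive_eq d _; rewrite /GRing.scale/=; ring.
have dp s := @is_derive1_comp R (pospow n) (fun u => s * (1 - u ^+ 2)) u _ _
  (is_derive1_pospow _ n1) (dv s).
have dF := is_deriveZ (2 * n)^-1 (is_deriveD (dp 1) (dp (-1))).
have -> : potential n = (2 * n)^-1 *:
   ((pospow n \o (fun u => 1 * (1 - u ^+ 2))) +
    (pospow n \o (fun u => -1 * (1 - u ^+ 2)))).
  apply/funext => z; rewrite /potential /=.
  change ((2 * n)^-1 * `|1 - z ^+ 2| `^ n = (2 * n)^-1 *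
    (pospow n (1 * (1 - z ^+ 2)) + pospow n (-1 * (1 - z ^+ 2)))).
  congr (_ * _); rewrite mul1r mulN1r; case: (leP 0 (1 - z ^+ 2)) => z0.
    by rewrite (ger0_norm z0) pospowE// (@pospow_le0 _ n (- _)) ?addr0
      ?oppr_le0.
  by rewrite (ltr0_norm z0) (@pospow_le0 _ n (1 - _)) ?ltW// add0r pospowE//
    oppr_ge0 ltW.
rewrite derive1E (@derive_val _ _ _ _ _ _ _ dF) /GRing.scale/= !mul1r !mulN1r.
rewrite pospowE// (@pospow_le0 _ (n - 1) (- _)) ?oppr_le0//;
  last by rewrite gt_eqF//; lra.
by field.
Qed.

Lemma p_flux_signed (R : realType) (p s c : R) :
    1 < p -> s ^+ 2 = 1 -> 0 <= c ->
  p_flux p (s * c) = s * c `^ (p - 1).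
Proof.
move=> p1 s1 c0; have s1' : `|s| = 1.
  have /orP[/eqP->|/eqP->] : (s == 1) || (s == -1) by rewrite -sqrf_eq1 s1.
    exact: normr1.
  exact: normrN1.
rewrite /p_flux normrM s1' mul1r (ger0_norm c0) mulrCA.
rewrite (_ : p - 2 = p - 1 - 1); last by ring.
by congr (_ * _); rewrite mulrC mulr_powRB1//; lra.
Qed.

(** * A single layer *)

(** The flux of s ka (1 - phi^2)^(n/p) is s ka^(p-1) (1 - phi^2)^be with
    be = (n/p) (p - 1) = n - n/p.  The bound be > 1 - n/p, required to
    differentiate it at the wells, is the hypothesis n > 1. *)
Lemma layer_near (R : realType) (n p ka s h x T : R) (w phi : R -> R) :
    1 < n -> n < p -> 0 < ka -> s ^+ 2 = 1 ->
    transition_profile (n / p) T w ->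
    (\forall y \near x, phi y = s * w (ka * (y - h))) ->
  [/\ derivable phi x 1,
      derive1 phi x = s * (ka * (1 - phi x ^+ 2) `^ (n / p)),
      {for x, continuous (derive1 phi)}
    & is_derive x 1 (p_flux p \o derive1 phi)
       (- (2 * (n - n / p) * ka `^ p * (phi x * (1 - phi x ^+ 2) `^ (n - 1))))].
Proof.
move=> n1 np ka0 s1 [dw dwpow _ wb _] nphi.
have p0 : 0 < p by lra.
have daff (y : R) : is_derive y 1 (fun y => ka * (y - h)) ka.
  have d := is_deriveZ ka (is_deriveB (is_derive_id y (1 : R))
    (is_derive_cst h y (1 : R))).
  by apply: is_derive_eq d _; rewrite /GRing.scale/= subr0 mulr1.
have sq y : phi y = s * w (ka * (y - h)) ->
    1 - phi y ^+ 2 = 1 - w (ka * (y - h)) ^+ 2.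
  by move=> ->; rewrite exprMn s1 mul1r.
have v0 t : 0 <= 1 - w t ^+ 2 by have := wb t => /andP[? ?]; nra.
have dphi y : (\forall z \near y, phi z = s * w (ka * (z - h))) ->
    is_derive (y : R) 1 phi (s * (ka * (1 - phi y ^+ 2) `^ (n / p))).
  move=> ny; have yE := nbhs_singleton ny.
  have d := is_deriveZ s
    (@is_derive1_comp R w (fun z => ka * (z - h)) y _ _ (dw _) (daff y)).
  apply: near_eq_is_derive.
    by near=> z; apply/esym; near: z; exact: ny.
  apply: is_derive_eq d _.
  by rewrite (sq y yE) /GRing.scale/= [ka * _ `^ _]mulrC.
have nd : \forall y \near x, phi y = s * w (ka * (y - h)) /\
    derive1 phi y = s * (ka * (1 - w (ka * (y - h)) ^+ 2) `^ (n / p)).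
  apply: filterS (nbhs_interior nphi) => y ny.
  have yE := nbhs_singleton ny; split=> //.
  by rewrite derive1E (@derive_val _ _ _ _ _ _ _ (dphi y ny)) sq.
have xE := nbhs_singleton nphi.
split.
- by have [] := dphi x nphi.
- by have [_ ->] := nbhs_singleton nd; rewrite sq.
- have wc : {for x, continuous
      (fun y => s * (ka * pospow (n / p) (1 - w (ka * (y - h)) ^+ 2)))}.
    apply: (@continuousM _ _ (cst s)); first exact: cst_continuous.
    apply: (@continuousM _ _ (cst ka)); first exact: cst_continuous.
    apply: (@continuous_comp _ _ _
        (fun y => 1 - w (ka * (y - h)) ^+ 2) (pospow (n / p))).
      have d := is_deriveB (is_derive_cst (1 : R) x (1 : R)) (is_deriveX 2
       (@is_derive1_comp R w (fun z => ka * (z - h)) x _ _ (dw _) (daff x))).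
      exact: is_derive1_continuous d.
    by apply: pospow_continuous; rewrite divr_gt0//; lra.
  have [_ dx] := nbhs_singleton nd.
  rewrite /prop_for /continuous_at dx -(pospowE (n / p) (v0 _)).
  apply: cvg_trans wc; apply: near_eq_cvg.
  near=> y; have [_ ->] : phi y = s * w (ka * (y - h)) /\
    derive1 phi y = s * (ka * (1 - w (ka * (y - h)) ^+ 2) `^ (n / p))
    by near: y; exact: nd.
  by rewrite pospowE.
- have npE : (n / p) * (p - 1) = n - n / p by field; rewrite gt_eqF.
  have npn : n / p < 1 by rewrite ltr_pdivrMr// mul1r.
  have dpow := dwpow (n - n / p) ltac:(lra).
  have d := is_deriveZ (s * ka `^ (p - 1))
    (@is_derive1_comp R (fun t => (1 - w t ^+ 2) `^ (n - n / p))
      (fun z => ka * (z - h)) x _ _ (dpow _) (daff x)).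
  apply: (@near_eq_is_derive _ _ _ (fun y =>
      s * ka `^ (p - 1) * (1 - w (ka * (y - h)) ^+ 2) `^ (n - n / p))).
    near=> y.
    have [_ dy] : phi y = s * w (ka * (y - h)) /\
      derive1 phi y = s * (ka * (1 - w (ka * (y - h)) ^+ 2) `^ (n / p))
      by near: y; exact: nd.
    rewrite /= dy p_flux_signed ?mulr_ge0 ?powR_ge0 ?(ltW ka0) ?(lt_trans n1)//.
    by rewrite powRM ?powR_ge0 ?(ltW ka0)// -powRrM npE mulrA.
  apply: is_derive_eq d _; rewrite sq// xE /GRing.scale/=.
  rewrite (_ : n - n / p + n / p - 1 = n - 1); last by ring.
  by rewrite -(@mulr_powRB1 _ ka p) ?(ltW ka0)//; ring.
Unshelve. all: by end_near. Qed.

(** * Products of well-separated layers *)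

Definition layer_train (R : realType) (w : R -> R) (N : nat) (h : 'I_N -> R)
  (s x : R) : R := s * \prod_i w (x - h i).

Lemma saturated_sqr (R : realType) (w : R -> R) (del : R) :
    (forall t, del <= t -> w t = 1 /\ w (- t) = -1) ->
  forall t, del <= `|t| -> w t ^+ 2 = 1.
Proof.
move=> sat t; have [t0|t0] := ger0P t => tdel.
  by rewrite (sat _ tdel).1 expr1n.
by rewrite -[t]opprK (sat _ tdel).2 sqrrN expr1n.
Qed.

Lemma saturated_near (R : realType) (w : R -> R) (del c x : R) :
    (forall t, del <= t -> w t = 1 /\ w (- t) = -1) -> 0 < del ->
    del < `|x - c| ->
  \forall y \near x, w (y - c) = w (x - c).
Proof.
move=> sat del0; have [x0|x0] := ger0P (x - c) => xdel.
  near=> y; rewrite (sat _ (ltW xdel)).1 (sat _ _).1//.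
  by rewrite lerBrDr; apply/ltW; near: y; apply: lt_nbhsr; lra.
near=> y; rewrite -[x - c]opprK -[y - c]opprK
  (sat _ (ltW xdel)).2 (sat _ _).2//.
by rewrite opprB lerBrDr addrC -lerBrDr; apply/ltW; near: y;
  apply: lt_nbhsl; lra.
Unshelve. all: by end_near. Qed.

(** At most one centre lies within del of x, and every other factor is constant
    near x. *)
Lemma layer_train_near (R : realType) (w : R -> R) (N : nat) (h : 'I_N -> R)
    (del s x : R) :
    (0 < N)%N -> 0 < del ->
    (forall t, del <= t -> w t = 1 /\ w (- t) = -1) ->
    (forall i j, i != j -> 2 * del < `|h i - h j|) -> s ^+ 2 = 1 ->
  exists i c, c ^+ 2 = 1 /\ \forall y \near x,
    layer_train w h s y = c * w (y - h i).
Proof.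
move=> N0 del0 sat sep s1.
have [i far] : exists i, forall j, j != i -> del < `|x - h j|.
  have [[i xi]|none] := pselect (exists i, `|x - h i| <= del).
    exists i => j ji; have := sep _ _ ji; have := ler_distD x (h j) (h i).
    by rewrite [`|h j - x|]distrC; lra.
  exists (Ordinal N0) => j _; rewrite ltNge; apply/negP => xj.
  by apply: none; exists j.
exists i, (s * \prod_(j | j != i) w (x - h j)); split.
  rewrite exprMn s1 mul1r -prodrXl big1// => j ji.
  by apply: (saturated_sqr sat); exact/ltW/far.
have nall : \forall y \near x, forall j, j != i -> w (y - h j) = w (x - h j).
  apply: (@filter_forall R 'I_N
    (fun j y => j != i -> w (y - h j) = w (x - h j)) (nbhs x) _).
  move=> j; have [->|ji] := eqVneq j i; first exact: nearW.
  by apply: filterS (saturated_near sat del0 (far j ji)) => y.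
apply: filterS nall => y yE.
rewrite /layer_train (bigD1 i)//= (eq_bigr (fun j => w (x - h j)))//.
by rewrite [w (y - _) * _]mulrC mulrA.
Qed.

Lemma layer_train_sqr (R : realType) (w : R -> R) (N : nat) (h : 'I_N -> R)
    (del s x : R) :
    (forall t, del <= t -> w t = 1 /\ w (- t) = -1) -> s ^+ 2 = 1 ->
    (forall i, del <= `|x - h i|) -> layer_train w h s x ^+ 2 = 1.
Proof.
move=> sat s1 far; rewrite exprMn s1 mul1r -prodrXl big1// => j _.
exact: saturated_sqr sat _ (far j).
Qed.

(** Between the two points only the i-th factor varies, and it changes sign. *)
Lemma layer_train_flip (R : realType) (w : R -> R) (N : nat) (h : 'I_N -> R)
    (del s : R) (i : 'I_N) :
    0 < del -> (forall t, del <= t -> w t = 1 /\ w (- t) = -1) ->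
    (forall i j, i != j -> 2 * del < `|h i - h j|) ->
  layer_train w h s (h i - del) = - layer_train w h s (h i + del).
Proof.
move=> del0 sat sep; rewrite /layer_train (bigD1 i)//= [in RHS](bigD1 i)//=.
have -> : h i - del - h i = - del by ring.
have -> : h i + del - h i = del by ring.
rewrite (sat _ (lexx _)).1 (sat _ (lexx _)).2.
rewrite mulN1r mul1r mulrN; congr (- (_ * _)); apply: eq_bigr => j ji.
have := sep _ _ ji; have [hj|hj] := ger0P (h j - h i) => hji.
  rewrite -[h i - del - h j]opprK -[h i + del - h j]opprK.
  by rewrite (sat _ _).2 ?(sat _ _).2//; lra.
by rewrite (sat _ _).1 ?(sat _ _).1//; lra.
Qed.

Lemma fin_pos_lower_bound (R : realType) (I : finType) (f : I -> R) :
  (forall i, 0 < f i) -> exists2 eta : R, 0 < eta & forall i, eta <= f i.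
Proof.
move=> f0; exists (\big[Num.min/1]_i f i); first exact: lt_bigmin.
by move=> i; exact: bigmin_le.
Qed.

(** The hypothesis on eps * ka says that the layers have the slope prescribed by
    the zero energy level. *)
Lemma layer_train_solution (R : realType) (a b n p eps : R) (N : nat)
    (h : 'I_N -> R) (del ka s : R) (w : R -> R) :
    a < b -> 1 < n -> n < p -> (0 < N)%N -> 0 < eps -> 0 < del -> 0 < ka ->
    (forall i, a + del < h i < b - del) ->
    (forall i j, i != j -> 2 * del < `|h i - h j|) ->
    s ^+ 2 = 1 ->
    2 * (n - n / p) * (eps * ka) `^ p = 1 ->
    transition_profile (n / p) (ka * del) w ->
  let phi := layer_train (fun t => w (ka * t)) h s in
  [/\ neumann_solution a b n p eps phi, oscillating a b phi
    & zeros_at a b h phi].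
Proof.
move=> ab n1 np N0 eps0 del0 ka0 hin sep s1 speed wP phi.
have [dw dwpow w0 wb wsat] := wP.
have p0 : 0 < p by lra.
have np0 : 0 < n / p by rewrite divr_gt0//; lra.
have sat t : del <= t -> w (ka * t) = 1 /\ w (ka * - t) = -1.
  by move=> dt; rewrite mulrN; apply: wsat; rewrite ler_pM2l.
have loc x := layer_train_near x N0 del0 sat sep s1.
have ode (x : R) : [/\ derivable phi x 1, phi x ^+ 2 = 1 -> derive1 phi x = 0,
    {for x, continuous (derive1 phi)} & is_derive x 1 (p_flux p \o derive1 phi)
       (- (2 * (n - n / p) * ka `^ p * (phi x * (1 - phi x ^+ 2) `^ (n - 1))))].
  have [i [c [c1 nx]]] := loc x.
  have [d dE cd flux] := layer_near n1 np ka0 c1 wP nx.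
  split; [exact: d| |exact: cd|exact: flux] => x1;
    rewrite dE [layer_train _ _ _ x ^+ 2]x1.
  by rewrite subrr powR0 ?mulr0 ?gt_eqF.
have phib x : -1 <= phi x <= 1.
  have [i [c [c1 /nbhs_singleton xE]]] := loc x.
  rewrite /phi xE; have /andP[? ?] := wb (ka * (x - h i)).
  have /orP[/eqP->|/eqP->] : (c == 1) || (c == -1) by rewrite -sqrf_eq1 c1.
    by rewrite mul1r; apply/andP.
  by rewrite mulN1r; apply/andP; split; lra.
have v0 x : 0 <= 1 - phi x ^+ 2 by have /andP[? ?] := phib x; nra.
have dphi (x : R) : is_derive x 1 phi (derive1 phi x).
  by have [d _ _ _] := ode x; rewrite derive1E; exact: derivableP.
have flat x : phi x ^+ 2 = 1 -> derive1 phi x = 0 by have [] := ode x.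
have far_flat x : (forall i, del <= `|x - h i|) -> phi x ^+ 2 = 1.
  exact: layer_train_sqr sat s1.
(* The derivative of the flux, in a form that is continuous on its face. *)
pose e x := - (2 * (n - n / p) * ka `^ p *
  (phi x * pospow (n - 1) (1 - phi x ^+ 2))).
split.
- apply: (@neumann_solution_of_is_derive _ a b n p eps phi (derive1 phi) e)
    => //.
  + by move=> x; have [] := ode x.
  + by move=> x; have [_ _ _] := ode x; rewrite /e pospowE.
  + move=> x; apply: (@continuousN _ _ _ (fun x => 2 * (n - n / p) * ka `^ p *
      (phi x * pospow (n - 1) (1 - phi x ^+ 2)))).
    apply: (@continuousM _ _ (cst (2 * (n - n / p) * ka `^ p)));
      first exact: cst_continuous.
    apply: (@continuousM _ _ phi); first exact: is_derive1_continuous (dphi x).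
    apply: (@continuous_comp _ _ _ (fun y => 1 - phi y ^+ 2) (pospow (n - 1))).
      have d := is_deriveB (is_derive_cst (1 : R) x (1 : R))
        (is_deriveX 2 (dphi x)).
      exact: is_derive1_continuous d.
    by apply: pospow_continuous; lra.
  + move=> x; rewrite derive1_potential// /e pospowE//.
    move: speed; rewrite powRM ?(ltW eps0) ?(ltW ka0)// => speed.
    set y := phi x * _.
    transitivity (- (2 * (n - n / p) * (eps `^ p * ka `^ p) * y));
      first by ring.
    by rewrite speed mul1r.
  + apply/flat/far_flat => i; have /andP[? ?] := hin i.
    by rewrite distrC ger0_norm; lra.
  + apply/flat/far_flat => i; have /andP[? ?] := hin i.
    by rewrite ger0_norm; lra.
- pose i := Ordinal N0.
  have /andP[hi1 hi2] := hin i.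
  have flip : phi (h i - del) = - phi (h i + del) :=
    layer_train_flip s i del0 sat sep.
  have in1 : h i - del \in `[a, b] by rewrite in_itv/=; apply/andP; split; lra.
  have in2 : h i + del \in `[a, b] by rewrite in_itv/=; apply/andP; split; lra.
  have : phi (h i + del) ^+ 2 = 1.
    apply: far_flat => j; have [<-|ij] := eqVneq i j.
      by rewrite addrAC subrr add0r ger0_norm ?lexx// ltW.
    have := sep _ _ ij; have := ler_distD (h i + del) (h i) (h j).
    by rewrite opprD addNKr normrN (gtr0_norm del0); lra.
  move/eqP; rewrite sqrf_eq1 => /orP[/eqP e1|/eqP e1].
    split => //; [exists (h i - del)|exists (h i + del)] => //.
    by rewrite flip e1.
  split => //; [exists (h i + del)|exists (h i - del)] => //.
  by rewrite flip e1 opprK.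
- move=> x _; have sn0 : s != 0.
    by apply/eqP => s0; move: s1; rewrite s0 expr0n => /eqP;
      rewrite eq_sym oner_eq0.
  split => [/eqP|[i ->]]; rewrite /phi /layer_train.
    rewrite mulf_eq0 (negPf sn0)/= => /prodf_eq0[i _ /eqP /w0 /eqP].
    by rewrite mulf_eq0 gt_eqF//= subr_eq0 => /eqP ->; exists i.
  by rewrite (bigD1 i)//= subrr mulr0 (w0 0).2 ?mul0r ?mulr0.
Qed.

Theorem proposition5 (R : realType) (a b n p : R) (N : nat) (h : 'I_N -> R)
    (hab : a < b) (hn : 1 < n) (hnp : n < p) (hN : (0 < N)%N)
    (h_in : forall i : 'I_N, a < h i < b)
    (h_incr : forall i j : 'I_N, (i < j)%N -> h i < h j) :
  exists2 eps0 : R, 0 < eps0 &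
    forall eps : R, 0 < eps < eps0 ->
      exists phi1 phi2 : R -> R,
        [/\ exists2 x, x \in `[a, b] & phi1 x <> phi2 x,
            [/\ neumann_solution a b n p eps phi1, oscillating a b phi1
              & zeros_at a b h phi1]
          & [/\ neumann_solution a b n p eps phi2, oscillating a b phi2
              & zeros_at a b h phi2]].
Proof.
have p0 : 0 < p by lra.
have al01 : 0 < n / p < 1.
  by rewrite divr_gt0 ?ltr_pdivrMr ?mul1r ?andTb//; lra.
have [w [T [T0 wP]]] := transition_profile_exists al01.
pose c := (2 * (n - n / p))^-1 `^ p^-1.
have np0 : 0 < 2 * (n - n / p) by have /andP[? ?] := al01; lra.
have c0 : 0 < c by rewrite powR_gt0// invr_gt0.
have cp : 2 * (n - n / p) * c `^ p = 1.
  by rewrite -powRrM mulVf ?gt_eqF// powRr1 ?divff ?gt_eqF// invr_ge0 ltW.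
have sep i j : i != j -> 0 < `|h i - h j|.
  rewrite normr_gt0 subr_eq0 => ij.
  have [/h_incr|/h_incr|/ord_inj/eqP] := ltngtP i j.
  - by move=> /lt_eqF ->.
  - by move=> /gt_eqF ->.
  - by rewrite (negPf ij).
have [eta eta0 etaP] : exists2 eta : R, 0 < eta &
    forall i j, [/\ eta <= h i - a, eta <= b - h i & i != j ->
      eta <= `|h i - h j|].
  have [|eta eta0 etaP] := @fin_pos_lower_bound R ('I_N * 'I_N)%type (fun ij =>
    Num.min (Num.min (h ij.1 - a) (b - h ij.1))
      (if ij.1 == ij.2 then 1 else `|h ij.1 - h ij.2|)).
    move=> [i j] /=; have /andP[? ?] := h_in i; rewrite !lt_min !subr_gt0.
    by apply/andP; split; [exact/andP|case: eqVneq => // /sep].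
  exists eta => // i j; have := etaP (i, j); rewrite /= !le_min.
  move=> /andP[/andP[-> ->]] ijP; split => // ij.
  by move: ijP; rewrite (negPf ij).
(* This is the value of eps for which twice the half-width T / ka equals eta. *)
exists (eta * c / (2 * T)); first by rewrite divr_gt0 ?mulr_gt0.
move=> eps /andP[eps0 epslt].
pose ka := c / eps.
pose del := T / ka.
have ka0 : 0 < ka by rewrite divr_gt0.
have del0 : 0 < del by rewrite divr_gt0.
have kadel : ka * del = T by rewrite /del mulrC divfK// gt_eqF.
have del_lt : 2 * del < eta.
  move: epslt; rewrite ltr_pdivlMr ?mulr_gt0//.
  have -> : del = T * eps / c by rewrite /del /ka invf_div mulrA.
  rewrite mulrA ltr_pdivrMr//; lra.
have speed : 2 * (n - n / p) * (eps * ka) `^ p = 1.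
  by rewrite /ka mulrCA divff ?mulr1// gt_eqF.
have hin i : a + del < h i < b - del.
  by have [? ? _] := etaP i i; apply/andP; split; lra.
have hsep i j : i != j -> 2 * del < `|h i - h j|.
  by move=> ij; have [_ _ /(_ ij)] := etaP i j; lra.
rewrite -kadel in wP.
have sol s : s ^+ 2 = 1 -> _ := fun s1 => layer_train_solution hab hn hnp hN
  eps0 del0 ka0 hin hsep s1 speed wP.
(* The problem is invariant under a change of sign. *)
exists (layer_train (fun t => w (ka * t)) h 1).
exists (layer_train (fun t => w (ka * t)) h (-1)).
split; [|by apply: sol; rewrite expr1n|by apply: sol; rewrite sqrrN expr1n].
have [_ [_ _ [x xab x1]] _] := sol 1 (expr1n _ _).
exists x => //; rewrite x1 => x2; move: x1 x2.
by rewrite /layer_train mul1r => ->; lra.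
Qed.
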